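(* Let $\mathcal{V}$ be a Euclidean Jordan algebra of rank $n$ with unit element $e$, and let $T:\mathcal{V}\to\mathcal{V}$ be a positive linear transformation. Let $\{e_1,e_2,\ldots,e_n\}$ be a Jordan frame in $\mathcal{V}$ and let $p=p_1e_1+p_2e_2+\cdots+p_ne_n$, where the real numbers $p_1,\ldots,p_n$ are distinct. Then the following statements are equivalent: (a) $T(h)=h$ for all $h\in\{e,p,p^2\}$. (b) $T(h)=h$ for all $h\in\operatorname{span}\{e_1,e_2,\ldots,e_n\}$. (c) $T^*(h)=h$ for all $h\in\operatorname{span}\{e_1,e_2,\ldots,e_n\}$. (d) $T^*(h)=h$ for all $h\in\{e,p,p^2\}$. Moreover, if any one of the conditions (a), (b), (c), (d) holds, then $T$ is doubly stochastic; hence $T(x)\prec x$ for all $x\in\mathcal{V}$.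
   Context: A Euclidean Jordan algebra is a finite-dimensional real inner product space $(\mathcal{V},\langle\cdot,\cdot\rangle)$ with a bilinear product $(x,y)\mapsto x\circ y$ satisfying $x\circ y=y\circ x$, $x\circ(x^2\circ y)=x^2\circ(x\circ y)$ with $x^2=x\circ x$, and $\langle x\circ y,z\rangle=\langle x,y\circ z\rangle$. It has a unit element $e$ (with $x\circ e=x$ for all $x$). Its symmetric cone is $K=\{x\circ x:x\in\mathcal{V}\}$; write $x\ge 0$ when $x\in K$. A nonzero $c$ with $c^2=c$ is an idempotent; it is primitive if it is not the sum of two other (nonzero) idempotents. A Jordan frame is a set $\{e_1,\ldots,e_n\}$ of mutually orthogonal primitive idempotents (equivalently, $e_i\circ e_j=0$ for $i\ne j$) with sum $e$; all Jordan frames have the same number $n$ of elements, called the rank of $\mathcal{V}$. By the spectral decomposition theorem every $x\in\mathcal{V}$ can be written $x=x_1e_1+\cdots+x_ne_n$ with real numbers $x_i$ (the eigenvalues of $x$, which do not depend on the decomposition) and some Jordan frame $\{e_1,\ldots,e_n\}$. The trace is $\operatorname{tr}(x)=x_1+\cdots+x_n$, and $\lambda(x)\in\mathbb{R}^n$ denotes the vector of eigenvalues of $x$ in decreasing order. A linear transformation $T:\mathcal{V}\to\mathcal{V}$ is positive if $x\ge0\Rightarrow T(x)\ge0$; unital if $T(e)=e$; trace-preserving if $\operatorname{tr}(T(x))=\operatorname{tr}(x)$ for all $x$; doubly stochastic if it is positive, unital and trace-preserving. $T^*$ is the adjoint of $T$ with respect to the given inner product. For $u,v\in\mathbb{R}^n$,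 $u^\downarrow$ is the decreasing rearrangement of $u$; $u\prec v$ means $\sum_{i=1}^k u_i^\downarrow\le\sum_{i=1}^k v_i^\downarrow$ for $k=1,\ldots,n$ with equality for $k=n$. For $x,y\in\mathcal{V}$, $x\prec y$ means $\lambda(x)\prec\lambda(y)$ in $\mathbb{R}^n$. *)

(* Defs.v *)
From HB Require Import structures.
From mathcomp Require Import all_boot all_order all_algebra.
From mathcomp Require Import boolp classical_sets reals.

Set Implicit Arguments.
Unset Strict Implicit.
Unset Printing Implicit Defensive.
Import Order.TTheory GRing.Theory Num.Theory.
Local Open Scope ring_scope.

(* Finite dimensionality is part of [Vector].  The unit is part of the
   structure: the remaining axioms alone do not provide one, as shown by the
   zero product. *)
HB.mixin Record isEuclideanJordan (R : realType) V of Vector R V := {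
  jmul : V -> V -> V;
  jdot : V -> V -> R;
  junit : V;
  jmul_linearl : forall y, linear (jmul^~ y);
  jmulC : forall x y, jmul x y = jmul y x;
  jmul_jordan : forall x y,
    jmul x (jmul (jmul x x) y) = jmul (jmul x x) (jmul x y);
  jmulx1 : forall x, jmul x junit = x;
  jdot_linearl : forall y, scalar (jdot^~ y);
  jdotC : forall x y, jdot x y = jdot y x;
  jdot_gt0 : forall x, x != 0 -> 0 < jdot x x;
  jdot_assoc : forall x y z, jdot (jmul x y) z = jdot x (jmul y z)
}.

#[short(type="euclideanJordanType")]
HB.structure Definition EuclideanJordan (R : realType) :=
  {V of isEuclideanJordan R V & Vector R V}.

Notation "x *J y" := (jmul x y) (at level 40, left associativity) : ring_scope.
Notation "''1J'" := junit : ring_scope.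

Section EuclideanJordanTheory.
Variables (R : realType) (V : euclideanJordanType R).
Implicit Types (x y : V) (T : 'End(V)).

Definition in_cone x : Prop := exists y, x = y *J y.

Definition idempotent x : Prop := x != 0 /\ x *J x = x.

Definition primitive_idempotent x : Prop :=
  idempotent x /\
  ~ (exists y z, [/\ idempotent y, idempotent z & x = y + z]).

(* Indexing loses nothing: orthogonal nonzero vectors are distinct. *)
Definition jordan_frame n (c : 'I_n -> V) : Prop :=
  [/\ forall i, primitive_idempotent (c i),
      forall i j, i != j -> jdot (c i) (c j) = 0
    & \sum_i c i = '1J].

(* The default values of [xget] below are never used: Jordan frames exist and
   have a common length, every element has a unique decreasing list of
   eigenvalues, and every endomorphism has a unique adjoint. *)
Definition jrank : nat :=
  xget 0%N [set n | exists c : 'I_n -> V, jordan_frame c]%classic.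

Definition eigenvalues x : jrank.-tuple R :=
  xget [tuple 0 | _ < jrank]
    [set l : jrank.-tuple R | sorted >=%R l /\
       exists2 c : 'I_jrank -> V,
         jordan_frame c & x = \sum_i tnth l i *: c i]%classic.

Definition jtrace x : R := \sum_i tnth (eigenvalues x) i.

Definition adjoint T : 'End(V) :=
  xget 0 [set S : 'End(V) | forall x y, jdot (T x) y = jdot x (S y)]%classic.

Definition positive_map T : Prop := forall x, in_cone x -> in_cone (T x).

Definition unital T : Prop := T '1J = '1J.

Definition trace_preserving T : Prop := forall x, jtrace (T x) = jtrace x.

Definition doubly_stochastic T : Prop :=
  [/\ positive_map T, unital T & trace_preserving T].

End EuclideanJordanTheory.

Arguments jrank {R} V.

Definition decreasing_rearrangement (R : realType) n (u : n.-tuple R) :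
  n.-tuple R := [tuple of sort >=%R u].

Definition partial_sum (R : realType) n (u : n.-tuple R) (k : nat) : R :=
  \sum_(i < n | (i < k)%N) tnth (decreasing_rearrangement u) i.

Definition majorized (R : realType) n (u v : n.-tuple R) : Prop :=
  (forall k, (1 <= k <= n)%N -> partial_sum u k <= partial_sum v k) /\
  partial_sum u n = partial_sum v n.

Definition jmajorized (R : realType) (V : euclideanJordanType R) (x y : V) :
  Prop := majorized (eigenvalues x) (eigenvalues y).

(* Main.v *)
From HB Require Import structures.
Require Import Defs.
From mathcomp Require Import all_boot all_order all_fingroup all_algebra.
From mathcomp Require Import boolp classical_sets reals.
From mathcomp Require Import ring lra complex.

(* Write [w i = <e_i,e_i>].  If [T] fixes [e], [p] and [p^2], then for each [i]
   the numbers [<T e_j, e_i> / w i] are nonnegative weights on the points [p_j],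
   with mean [p_i] and variance 0; the [p_j] being distinct, [<T e_j, e_i> = 0]
   for [i != j].  Elements of the cone that are orthogonal to an idempotent
   have product 0 with it, so [T e_j] lies in the Peirce space of [e_j] for the
   eigenvalue 1, which is the line of [e_j]; hence [T e_j = e_j].  The relation
   [<T e_j, e_i> = 0] is symmetric in [T] and its adjoint, and the adjoint is
   positive because the cone is self-dual.

   The spectral theorem comes from the minimal polynomial of [x], which has
   simple real roots: multiplication by [x] is self-adjoint, which forbids the
   factors [(X - a)^2 + b^2], including [b = 0].  The trace and the rank do not
   depend on the Jordan frame because two primitive idempotents that are not
   orthogonal have the same norm, so that [<e_i, f_j> / <e_i, e_i>] is a doubly
   stochastic matrix for any two frames.  Likewise, [T x] and [x] have
   eigenvalues related by a doubly stochastic matrix. *)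

Set Implicit Arguments.
Unset Strict Implicit.
Unset Printing Implicit Defensive.
Import Order.TTheory GRing.Theory Num.Theory.
Local Open Scope ring_scope.

(** * Polarized Jordan identity *)

Section Bilinearity.
Variables (R : realType) (V : euclideanJordanType R).
Implicit Types (x y z a b c u : V) (k : R).

Fact jmul_linear_subproof x : linear (jmul x).
Proof. by move=> k y z; rewrite !(jmulC x) jmul_linearl. Qed.
HB.instance Definition _ x :=
  GRing.isLinear.Build R V V _ (jmul x) (jmul_linear_subproof x).

Fact jdot_linear_subproof x : scalar (jdot x).
Proof. by move=> k y z; rewrite !(jdotC x) jdot_linearl. Qed.
HB.instance Definition _ x :=
  GRing.isLinear.Build R V R _ (jdot x) (jdot_linear_subproof x).

Lemma jmulDl x y z : (x + y) *J z = x *J z + y *J z.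
Proof. by rewrite jmulC linearD /= !(jmulC z). Qed.
Lemma jmulDr x y z : z *J (x + y) = z *J x + z *J y.
Proof. exact: linearD. Qed.
Lemma jmulZl k x z : (k *: x) *J z = k *: (x *J z).
Proof. by rewrite jmulC linearZ /= !(jmulC z). Qed.
Lemma jmulZr k x z : z *J (k *: x) = k *: (z *J x).
Proof. exact: linearZ. Qed.
Lemma jmulNl x z : (- x) *J z = - (x *J z).
Proof. by rewrite jmulC linearN /= !(jmulC z). Qed.
Lemma jmulNr x z : z *J (- x) = - (z *J x).
Proof. exact: linearN. Qed.
Lemma jmul0l z : 0 *J z = 0.
Proof. by rewrite jmulC linear0. Qed.
Lemma jmul0r z : z *J 0 = 0.
Proof. exact: linear0. Qed.

Lemma jdotDl x y z : jdot (x + y) z = jdot x z + jdot y z.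
Proof. by rewrite jdotC linearD /= !(jdotC z). Qed.
Lemma jdotDr x y z : jdot z (x + y) = jdot z x + jdot z y.
Proof. exact: linearD. Qed.
Lemma jdotZl k x z : jdot (k *: x) z = k * jdot x z.
Proof. by rewrite jdotC linearZ /= !(jdotC z). Qed.
Lemma jdotZr k x z : jdot z (k *: x) = k * jdot z x.
Proof. exact: linearZ. Qed.
Lemma jdotNl x z : jdot (- x) z = - jdot x z.
Proof. by rewrite jdotC linearN /= !(jdotC z). Qed.
Lemma jdotNr x z : jdot z (- x) = - jdot z x.
Proof. exact: linearN. Qed.
Lemma jdot0l z : jdot 0 z = 0.
Proof. by rewrite jdotC linear0. Qed.
Lemma jdot0r z : jdot z 0 = 0.
Proof. exact: linear0. Qed.
Definition jdotE := (jdotDl, jdotDr, jdotZl, jdotZr, jdotNl, jdotNr, jdot0l, jdot0r).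
Definition jmulE := (jmulDl, jmulDr, jmulZl, jmulZr, jmulNl, jmulNr, jmul0l, jmul0r).

Lemma jdot_suml (I : Type) (r : seq I) (P : pred I) (F : I -> V) z :
  jdot (\sum_(i <- r | P i) F i) z = \sum_(i <- r | P i) jdot (F i) z.
Proof. by rewrite jdotC linear_sum; apply: eq_bigr => i _ /=; rewrite jdotC. Qed.

Lemma jmul_suml (I : Type) (r : seq I) (P : pred I) (F : I -> V) z :
  (\sum_(i <- r | P i) F i) *J z = \sum_(i <- r | P i) F i *J z.
Proof. by rewrite jmulC linear_sum; apply: eq_bigr => i _ /=; rewrite jmulC. Qed.

Lemma jdot_ge0 x : 0 <= jdot x x.
Proof.
have [->|/jdot_gt0/ltW //] := eqVneq x 0; by rewrite jdot0l.
Qed.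

Lemma jdot_eq0 x : (jdot x x == 0) = (x == 0).
Proof.
have [->|/jdot_gt0/lt0r_neq0/negbTE //] := eqVneq x 0; by rewrite jdot0l eqxx.
Qed.

(** Pairing with an arbitrary [z] turns an identity between vectors into one between real numbers,
    where [ring] and [lra] apply. *)
Lemma jdot_inj x y : (forall z, jdot x z = jdot y z) -> x = y.
Proof.
move=> h; apply/eqP; rewrite -subr_eq0 -jdot_eq0 jdotDl jdotNl.
by rewrite h subrr.
Qed.

Lemma jdot_sqr x : jdot (x *J x) '1J = jdot x x.
Proof. by rewrite jdot_assoc jmulx1. Qed.

(** The commutator of the multiplications by [a] and by [b *J c], applied to [y]; the Jordan axiom
    says that it vanishes when [a], [b], [c] coincide. *)
Let assoc3 y a b c := a *J ((b *J c) *J y) - (b *J c) *J (a *J y).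

(** A trilinear map that is symmetric in its last two arguments and zero on the diagonal has zero
    cyclic sums. *)
Lemma jordan_polarized a b c y :
  a *J ((b *J c) *J y) + b *J ((c *J a) *J y) + c *J ((a *J b) *J y) =
  (b *J c) *J (a *J y) + (c *J a) *J (b *J y) + (a *J b) *J (c *J y).
Proof.
have G0 x : assoc3 y x x x = 0 by rewrite /assoc3 jmul_jordan subrr.
have GC r s t : assoc3 y r s t = assoc3 y r t s.
  by rewrite /assoc3 (jmulC s).
have GDl r s t w : assoc3 y (r + w) s t = assoc3 y r s t + assoc3 y w s t.
  by apply: jdot_inj => z; rewrite /assoc3 !jmulE !jdotE; ring.
have GDr r s t w : assoc3 y r (s + w) t = assoc3 y r s t + assoc3 y r w t.
  by apply: jdot_inj => z; rewrite /assoc3 !jmulE !jdotE; ring.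
have GDc r s t w : assoc3 y r s (t + w) = assoc3 y r s t + assoc3 y r s w.
  by rewrite GC GDr !(GC _ _ s).
have GNl r s t : assoc3 y (- r) s t = - assoc3 y r s t.
  by apply: jdot_inj => z; rewrite /assoc3 !jmulE !jdotE; ring.
have GNr r s t : assoc3 y r (- s) t = - assoc3 y r s t.
  by apply: jdot_inj => z; rewrite /assoc3 !jmulE !jdotE; ring.
have GNc r s t : assoc3 y r s (- t) = - assoc3 y r s t.
  by rewrite GC GNr !(GC _ _ s).
(* Adding the expansions at [r + s] and [r - s] cancels the terms of odd degree in [s]. *)
have H r s : assoc3 y r s s + assoc3 y s r s + assoc3 y s r s = 0.
  apply: jdot_inj => z.
  have := G0 (r + s); have := G0 (r - s).
  rewrite !(GDl, GDr, GDc, GNl, GNr, GNc) !(GC s s r) !(GC r s r) !G0.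
  move=> /(congr1 (jdot^~ z)); rewrite !jdotE => h1.
  move=> /(congr1 (jdot^~ z)); rewrite !jdotE => h2.
  lra.
(* This is half of [H a (b + c) - H a b - H a c]. *)
have K : assoc3 y a b c + assoc3 y b c a + assoc3 y c a b = 0.
  apply: jdot_inj => z.
  have := H a (b + c); have := H a b; have := H a c.
  rewrite !(GDl, GDr, GDc) !(GC b a c) (GC a c b).
  move=> /(congr1 (jdot^~ z)); rewrite !jdotE => h1.
  move=> /(congr1 (jdot^~ z)); rewrite !jdotE => h2.
  move=> /(congr1 (jdot^~ z)); rewrite !jdotE => h3.
  lra.
apply: jdot_inj => z; move: K; rewrite /assoc3.
move=> /(congr1 (jdot^~ z)); rewrite !jdotE => h1.
lra.
Qed.

End Bilinearity.

(** * Idempotents and powers *)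

Section Peirce.
Variables (R : realType) (V : euclideanJordanType R).
Implicit Types (x y z c u : V) (k : R).

(** The polynomial [2 X^3 - 3 X^2 + X] has the roots 0, 1/2 and 1, the Peirce eigenvalues. *)
Lemma peirce_cubic c x : c *J c = c ->
  2 *: (c *J (c *J (c *J x))) + c *J x = 3 *: (c *J (c *J x)).
Proof.
move=> cc; apply: jdot_inj => z.
have := jordan_polarized c c x c.
rewrite !cc (jmulC x c) !(jmulC (c *J x) c).
move=> /(congr1 (jdot^~ z)); rewrite !jdotE => h; lra.
Qed.

Lemma peirce1_comm u x y : u *J u = u -> u *J x = x ->
  u *J (x *J y) = x *J (u *J y).
Proof.
move=> uu ux; apply: jdot_inj => z.
have := jordan_polarized u u x y; rewrite uu ux (jmulC x u) ux.
move=> /(congr1 (jdot^~ z)); rewrite !jdotE => h; lra.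
Qed.

Lemma peirce0_comm u x y : u *J u = u -> u *J x = 0 ->
  u *J (x *J y) = x *J (u *J y).
Proof.
move=> uu ux; apply: jdot_inj => z.
have := jordan_polarized u u x y; rewrite uu ux (jmulC x u) ux !jmulE.
move=> /(congr1 (jdot^~ z)); rewrite !jdotE => h; lra.
Qed.

(* With [L] the multiplication by [c], [L (2 L - 1)] and [4 L (1 - L)] are the
   projections on the eigenspaces of [L] for 1 and 1/2. *)
Lemma idem_dot_sos c x : c *J c = c -> let y := c *J x in let z := c *J y in
  jdot y x = jdot (2 *: z - y) (2 *: z - y) + 8 * jdot (y - z) (y - z).
Proof.
move=> cc y z.
have cz : 2 *: (c *J z) = 3 *: z - y.
  by rewrite -[LHS](addrK y) peirce_cubic.
have m2 : jdot z x = jdot y y by rewrite /z jmulC jdot_assoc.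
have m3 : jdot z y = jdot (c *J z) x by rewrite (jmulC c z) jdot_assoc.
have m4 : jdot z z = jdot (c *J z) y by rewrite (jmulC c z) jdot_assoc.
move: (congr1 (jdot^~ x) cz) (congr1 (jdot^~ y) cz); rewrite !jdotE m2 -m3 -m4.
rewrite !(jdotC y z); lra.
Qed.

Lemma idem_dot_ge0 c x : c *J c = c -> 0 <= jdot (c *J x) x.
Proof.
by move=> cc; rewrite idem_dot_sos // addr_ge0 ?mulr_ge0 ?jdot_ge0.
Qed.

Lemma idem_dot_eq0 c x : c *J c = c -> jdot (c *J x) x = 0 -> c *J x = 0.
Proof.
move=> cc /eqP; rewrite idem_dot_sos // paddr_eq0 ?mulr_ge0 ?jdot_ge0 //.
rewrite jdot_eq0 mulf_eq0 pnatr_eq0 jdot_eq0 /= => /andP[/eqP h1 /eqP h2].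
(* The two summands are the components of [c *J x] in the Peirce spaces for 1/2 and 1. *)
have -> : c *J x = 2 *: (c *J x - c *J (c *J x)) + (2 *: (c *J (c *J x)) - c *J x).
  by apply: jdot_inj => z; rewrite !jdotE; ring.
by rewrite h1 h2 scaler0 addr0.
Qed.

Lemma idem_sqr_dot_ge0 c x : c *J c = c -> 0 <= jdot c (x *J x).
Proof. by move=> cc; rewrite -jdot_assoc idem_dot_ge0. Qed.

(** The pairing equals [jdot (c *J x) x], so [c *J x = 0]; the multiplications by [c] and [x] then
    commute, and [c *J (x *J x) = x *J (c *J x)]. *)
Lemma idem_sqr_dot_eq0 c x : c *J c = c -> jdot c (x *J x) = 0 ->
  c *J (x *J x) = 0.
Proof.
move=> cc; rewrite -jdot_assoc => /(idem_dot_eq0 cc) cx.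
by rewrite peirce0_comm // cx jmul0r.
Qed.

Lemma idem_orth c d : c *J c = c -> d *J d = d -> jdot c d = 0 -> c *J d = 0.
Proof. by move=> cc dd; rewrite -dd; apply: idem_sqr_dot_eq0. Qed.

Lemma idem_dot_idem_ge0 c d : c *J c = c -> d *J d = d -> 0 <= jdot c d.
Proof. by move=> cc dd; rewrite -dd; apply: idem_sqr_dot_ge0. Qed.

End Peirce.

(** * Powers of one element and polynomial calculus *)

Section Powers.
Variables (R : realType) (V : euclideanJordanType R) (u x : V).
Hypotheses (uu : u *J u = u) (ux : u *J x = x).
Implicit Types (y z t : V) (q r : {poly R}).

(* [u] stands for [x ^ 0]: this gives the spectral theorem in each Peirce space
   [u *J x = x], and not only for [u = '1J]. *)
Definition jpow i : V := iter i (jmul x) u.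

Definition jeval q : V := \sum_(i < size q) q`_i *: jpow i.

Lemma jpowS i : jpow i.+1 = x *J jpow i. Proof. by []. Qed.

(** The polarized identity at [x], [jpow i], [t], applied to [x], writes the multiplication by a
    power through multiplications by lower powers. *)
Lemma jpow_rec i t : jpow i.+2 *J t =
  x *J x *J (jpow i *J t) + 2 *: (jpow i.+1 *J (x *J t))
  - x *J (x *J (jpow i *J t)) - jpow i *J (x *J (x *J t)).
Proof.
have := jordan_polarized x (jpow i) t x.
rewrite (jmulC t x) (jmulC (jpow i) x) -!jpowS !(jmulC _ x) -!jpowS.
rewrite (jmulC t) (jmulC _ (x *J x)) (jmulC (x *J t) (jpow i.+1)) => h.
by apply: jdot_inj => z; move: (congr1 (jdot^~ z) h); rewrite !jdotE; lra.
Qed.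

Lemma sqr_comm t : x *J x *J (x *J t) = x *J (x *J x *J t).
Proof. by rewrite jmul_jordan. Qed.

Lemma jpow_comm i : (forall t, jpow i *J (x *J t) = x *J (jpow i *J t)) /\
  (forall t, jpow i *J (x *J x *J t) = x *J x *J (jpow i *J t)).
Proof.
(* The recursion [jpow_rec] goes back two steps, so the induction carries two consecutive powers; it
   also contains the multiplication by [x *J x], hence the second commutation. *)
suff [] : ((forall t, jpow i *J (x *J t) = x *J (jpow i *J t)) /\
  (forall t, jpow i *J (x *J x *J t) = x *J x *J (jpow i *J t))) /\
  ((forall t, jpow i.+1 *J (x *J t) = x *J (jpow i.+1 *J t)) /\
  (forall t, jpow i.+1 *J (x *J x *J t) = x *J x *J (jpow i.+1 *J t))) by [].
elim: i => [|i [[A1 A2] [B1 B2]]].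
  have -> : jpow 1 = x by rewrite jpowS jmulC.
  split; split=> t //=; try exact: peirce1_comm.
    by apply: peirce1_comm; rewrite // peirce1_comm // ux.
  by rewrite sqr_comm.
split; split=> // t; rewrite !jpow_rec !jmulE.
  by rewrite !(A1, A2, B1, B2, sqr_comm).
by rewrite -!sqr_comm !(A1, A2, B1, B2) -!sqr_comm ?(A1, A2, B1, B2).
Qed.

Lemma jpow_unit i : u *J jpow i = jpow i.
Proof. by elim: i => // i IH; rewrite jpowS peirce1_comm // IH. Qed.

Lemma jeval_wide n q : (size q <= n)%N -> jeval q = \sum_(i < n) q`_i *: jpow i.
Proof.
move=> qn; rewrite /jeval (big_ord_widen n (fun i => q`_i *: jpow i) qn).
rewrite big_mkcond; apply: eq_bigr => i _; case: ltnP => // qi.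
by rewrite nth_default // scale0r.
Qed.

Fact jeval_linear : linear jeval.
Proof.
move=> k q r; pose n := maxn (size (k *: q + r)) (maxn (size q) (size r)).
rewrite !(@jeval_wide n) ?leq_max ?leqnn ?orbT //.
rewrite scaler_sumr -big_split /=; apply: eq_bigr => i _.
by rewrite coefD coefZ scalerDl scalerA.
Qed.
HB.instance Definition _ := GRing.isLinear.Build R {poly R} V _ jeval jeval_linear.

Lemma jevalC k : jeval k%:P = k *: u.
Proof.
rewrite (@jeval_wide 1) ?size_polyC ?leq_b1 // big_ord1 coefC eqxx //.
Qed.

Lemma jevalMX q : jeval (q * 'X) = x *J jeval q.
Proof.
rewrite (@jeval_wide (size q).+1) ?big_ord_recl.
  rewrite coefMX scale0r add0r /jeval linear_sum.
  by apply: eq_bigr => i _ /=; rewrite coefMX jmulZr.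
by rewrite (leq_trans (size_polyMleq _ _)) // size_polyX addnC.
Qed.

Lemma jevalX : jeval 'X = x.
Proof. by rewrite -[X in jeval X]mul1r jevalMX -[1]/(1%:P) jevalC scale1r jmulC. Qed.

Lemma jeval_comm q t : jeval q *J (x *J t) = x *J (jeval q *J t).
Proof.
rewrite !jmul_suml linear_sum; apply: eq_bigr => i _ /=.
by rewrite !jmulE (jpow_comm i).1.
Qed.

Lemma jeval_unit q : u *J jeval q = jeval q.
Proof. by rewrite linear_sum; apply: eq_bigr => i _; rewrite /= jmulZr jpow_unit. Qed.

(** This is power associativity. In the induction on [q], [jeval_comm] moves the factor [x] out past
    [jeval r]. *)
Lemma jevalM q r : jeval (q * r) = jeval q *J jeval r.
Proof.
elim/poly_ind: q => [|q k IH]; first by rewrite mul0r !linear0 jmul0l.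
rewrite mulrDl mulrAC !linearD /= !jevalMX IH jmulDl jevalC jmulZl jeval_unit.
by rewrite mul_polyC linearZ /= (jmulC (x *J _)) jeval_comm (jmulC (jeval r)).
Qed.

End Powers.

(** * Spectral theorem *)

Section RealPolynomials.
Variable R : rcfType.
Implicit Types (h q : {poly R}) (a b : R).

Lemma size_quadratic a b : size (('X - a%:P) ^+ 2 + (b ^+ 2)%:P) = 3.
Proof.
by rewrite size_polyDl size_exp_XsubC // (leq_ltn_trans (size_polyC_leq1 _)).
Qed.

(** The remainder of [h] has degree at most 1 and real coefficients; vanishing at a non-real point,
    it is zero. *)
Lemma complex_root_dvdp h (a b : R) : b != 0 ->
  root (map_poly (real_complex R) h) (Complex a b) ->
  ('X - a%:P) ^+ 2 + (b ^+ 2)%:P %| h.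
Proof.
move=> b0 /rootP hz; set Q := _ + _.
have sQ : size Q = 3 := size_quadratic a b.
have Q0 : Q != 0 by rewrite -size_poly_eq0 sQ.
have := ltn_modp h Q; rewrite Q0 sQ ltnS; set r := h %% Q => sr.
have rE : r = (r`_0)%:P + r`_1 *: 'X.
  apply/polyP => i; rewrite !coefE; case: i => [|[|i]] /=.
  - by rewrite mulr0 addr0.
  - by rewrite mulr1 add0r.
  - by rewrite nth_default ?mulr0 ?addr0 // (leq_trans sr).
have Qz : (map_poly (real_complex R) Q).[Complex a b] = 0.
  rewrite rmorphD rmorphXn rmorphB /= map_polyX !map_polyC /= !hornerE.
  by apply/eqP; rewrite eq_complex /=; apply/andP; split; apply/eqP => /=; ring.
move: hz; rewrite (divp_eq h Q) -/r rmorphD rmorphM /= hornerD hornerM Qz mulr0 add0r.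
rewrite rE rmorphD /= map_polyC map_polyZ map_polyX !hornerE /= => /eqP.
rewrite eq_complex /= !mul0r !subr0 !add0r !addr0 => /andP[/eqP r0 /eqP r1].
have r10 : r`_1 = 0 by apply/eqP; move/eqP: r1; rewrite mulf_eq0 (negbTE b0) orbF.
have r00 : r`_0 = 0 by move: r0; rewrite r10 mul0r addr0.
by rewrite r10 r00 scale0r !addr0 dvdp_mull.
Qed.

(** The divisors with [b != 0] exclude non-real roots, and those with [b = 0] exclude double roots,
    whence [uniq rs]. *)
Lemma real_split h : h != 0 ->
  (forall a b, ~~ (('X - a%:P) ^+ 2 + (b ^+ 2)%:P %| h)) ->
  exists2 rs : seq R, uniq rs & h %= \prod_(r <- rs) ('X - r%:P).
Proof.
move: {2}(size h) (leqnn (size h)) => n; elim: n h => [|n IH] h.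
  by rewrite leqn0 size_poly_eq0 => /eqP -> /eqP.
move=> sh h0 hQ; have [h1|h1] := eqVneq (size h) 1.
  by exists [::]; rewrite // big_nil -size_poly_eq1 h1.
have /closed_rootP[[a b] hz] : size (map_poly (real_complex R) h) != 1.
  by rewrite size_map_poly.
have [b0|/complex_root_dvdp/(_ hz)] := eqVneq b 0; last by rewrite (negbTE (hQ a b)).
have /factor_theorem[k hE] : root h a.
  have := hz; rewrite /root b0 -[Complex a 0]/(real_complex R a) horner_map.
  by rewrite fmorph_eq0.
have k0 : k != 0 by apply: contraNneq h0 => k0; rewrite hE k0 mul0r.
have sk : (size k <= n)%N.
  by move: sh; rewrite hE size_Mmonic ?monicXsubC // size_XsubC addn2.
have [|rs urs krs] := IH k sk k0.
  by move=> a' b'; apply: contra (hQ a' b') => kd; rewrite hE dvdp_mulr.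
exists (a :: rs).
  rewrite /= urs andbT; apply/negP => ars.
  have := hQ a 0; rewrite expr0n addr0 expr2 hE dvdp_mul2r ?polyXsubC_eq0 //.
  by rewrite (eqp_dvdr _ krs) dvdp_XsubCl root_prod_XsubC ars.
by rewrite big_cons hE mulrC eqp_mull.
Qed.

End RealPolynomials.

Section Spectral.
Variables (R : realType) (V : euclideanJordanType R).
Implicit Types (u x y z : V) (s : seq V) (q : {poly R}).

Lemma jeval_annihilated u x : exists q, q != 0 /\ jeval u x q = 0.
Proof.
pose n := (\dim {: V}).+1; pose X := [tuple jpow u x i | i < n].
have /negP : ~~ free X.
  apply/negP; rewrite /free size_tuple => /eqP h.
  by have := dimvS (subvf <<X>>); rewrite h ltnn.
move=> nf; suff [k k0 [i ki]] : exists2 k : 'I_n -> R,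
    \sum_i k i *: X`_i = 0 & exists i, k i != 0.
  exists (\poly_(j < n) k (inord j)); split.
    apply/eqP => /(congr1 (fun q : {poly R} => q`_i)).
    by rewrite coef_poly ltn_ord inord_val coef0 => /eqP; rewrite (negbTE ki).
  rewrite (@jeval_wide _ _ _ _ n) ?size_poly // -[RHS]k0.
  apply: eq_bigr => j _; rewrite coef_poly ltn_ord inord_val.
  by rewrite -tnth_nth tnth_mktuple.
apply: contra_notP nf => H; apply/freeP => k k0 i.
by apply/eqP; apply: contra_notT H => ki; exists k => //; exists i.
Qed.

(** The members need not be primitive; primitivity comes later from a decomposition of maximal
    size. *)
Definition orth_idem_decomp u s :=
  [/\ forall c, c \in s -> c != 0 /\ c *J c = c,
      uniq s /\ {in s &, forall y z, y != z -> jdot y z = 0}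
    & \sum_(c <- s) c = u].

Lemma spectral_idempotents u x : u *J u = u -> u *J x = x ->
  exists2 s, orth_idem_decomp u s & x \in <<s>>%VS.
Proof.
move=> uu ux; pose ev := jeval u x.
have [q [q0 evq] qmin] : exists2 q, q != 0 /\ ev q = 0 &
    forall r, r != 0 -> ev r = 0 -> (size q <= size r)%N.
  pose P n := `[< exists q, [/\ q != 0, ev q = 0 & size q = n] >].
  have exP : exists n, P n.
    have [q [q0 eq0]] := jeval_annihilated u x.
    by exists (size q); apply/asboolP; exists q.
  case: (ex_minnP exP) => n /asboolP[q [q0 eq0 <-]] nmin.
  by exists q => // r r0 er0; apply: nmin; apply/asboolP; exists r.
have evM r t : ev (r * t) = ev r *J ev t by apply: jevalM.
have [rs urs qrs] : exists2 rs : seq R, uniq rs & q %= \prod_(r <- rs) ('X - r%:P).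
  apply: real_split => // a b; apply/negP => /dvdpP[k qE].
  have k0 : k != 0 by apply: contraNneq q0 => k0; rewrite qE k0 mul0r.
  (* As multiplication by [x] is self-adjoint, [jdot (ev q) y] is a sum of two nonnegative terms,
     the first being the squared norm of [w]. So [w = 0], against the minimality of [q]. *)
  pose w := ev (('X - a%:P) * k); pose y := ev k.
  have w0 : w = 0.
    have : jdot (ev q) y = jdot w w + b ^+ 2 * jdot y y.
      rewrite qE mulrC mulrDl mul_polyC /ev linearD linearZ /= jdotDl jdotZl -/ev.
      by rewrite expr2 -mulrA evM jmulC jdot_assoc -evM.
    rewrite evq jdot0l => /esym/eqP.
    rewrite paddr_eq0 ?jdot_ge0 //; last by rewrite mulr_ge0 ?sqr_ge0 ?jdot_ge0.
    by rewrite jdot_eq0 => /andP[/eqP].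
  have := qmin (('X - a%:P) * k) _ w0.
  rewrite mulf_neq0 ?polyXsubC_eq0 // => /(_ isT).
  rewrite qE size_mul // ?size_quadratic -?size_poly_eq0 ?size_quadratic //.
  rewrite [_ * k]mulrC size_Mmonic ?monicXsubC // size_XsubC.
  by rewrite addn3 addn2 ltnn.
have evq0 r : q %| r -> ev r = 0.
  by case/dvdpP => k ->; rewrite evM evq jmul0r.
(* The Lagrange numerator at the root [r]. *)
pose m r : {poly R} := \prod_(t <- rem r rs) ('X - t%:P).
have qm r : r \in rs -> q %= ('X - r%:P) * m r.
  move=> rrs; rewrite /m (eqp_trans qrs) // (perm_big _ (perm_to_rem rrs)).
  by rewrite big_cons eqpxx.
have m0 r : m r != 0.
  by apply/monic_neq0/monic_prod => t _; apply: monicXsubC.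
have em0 r : r \in rs -> ev (m r) != 0.
  move=> rrs; apply/eqP => /(qmin _ (m0 r)).
  rewrite (eqp_size (qm r rrs)) [_ * m r]mulrC size_Mmonic ?monicXsubC //.
  by rewrite size_XsubC addn2 ltnn.
(* The polynomial [g - g.[r]] has the root [r], so its product with [m r] is a multiple of [q]. *)
have evg r (g : {poly R}) : r \in rs -> ev (g * m r) = g.[r] *: ev (m r).
  move=> rrs; have /factor_theorem[k gE] : root (g - (g.[r])%:P) r.
    by rewrite rootE !hornerE subrr.
  apply/eqP; rewrite -subr_eq0 /ev -linearZ -linearB /= -mul_polyC -mulrBl gE -mulrA -/ev.
  by rewrite evq0 // dvdp_mull // (eqp_dvdl _ (qm r rrs)).
have mr0 r t : r \in rs -> t \in rs -> ((m r).[t] != 0) = (r == t).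
  move=> rrs trs; rewrite -rootE root_prod_XsubC mem_rem_uniq // inE /= trs andbT.
  by rewrite negbK eq_sym.
(* The Lagrange interpolation polynomial at [r], evaluated at [x]: an eigenvector of the
   multiplication by [x]. *)
pose c r := (m r).[r]^-1 *: ev (m r).
have xc r : r \in rs -> x *J c r = r *: c r.
  move=> rrs; rewrite jmulZr -[X in X *J _](jevalX ux) -/ev -evM evg // hornerX.
  by rewrite !scalerA mulrC.
have sumc : \sum_(r <- rs) c r = u.
  rewrite -[u in RHS]scale1r -(jevalC u x) /c /ev.
  apply/esym/eqP; rewrite -subr_eq0.
  under eq_bigr do rewrite -linearZ /=.
  rewrite -linear_sum -linearB /=; apply/eqP/evq0.
  (* The Lagrange polynomials add up to 1 at each root of [q], hence modulo [q]. *)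
  rewrite (eqp_dvdl _ qrs) uniq_roots_dvdp ?uniq_rootsE //.
  apply/allP => t trs; rewrite rootE !hornerE horner_sum.
  rewrite (bigD1_seq t) //= hornerZ mulVf ?mr0 // big_seq_cond big1 ?addr0 ?subrr //.
  move=> r /andP[rrs rt]; rewrite hornerZ; apply/eqP; rewrite mulf_eq0.
  by rewrite -[_.[t] == 0]negbK mr0 // rt orbT.
have c0 r : r \in rs -> c r != 0.
  by move=> rrs; rewrite scaler_eq0 invr_eq0 negb_or mr0 // eqxx em0.
have orthc r t : r \in rs -> t \in rs -> r != t -> jdot (c r) (c t) = 0.
  move=> rrs trs rt; apply/eqP.
  have /eqP : (r - t) * jdot (c r) (c t) = 0.
    by rewrite mulrBl -jdotZl -xc // jmulC jdot_assoc xc // jdotZr subrr.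
  by rewrite mulf_eq0 subr_eq0 (negbTE rt).
exists [seq c r | r <- rs].
  split; last by rewrite big_map.
    move=> _ /mapP[r rrs ->]; split; first exact: c0.
    by rewrite jmulZl jmulZr -evM evg // !scalerA mulfVK // mr0.
  split.
    rewrite map_inj_in_uniq // => r t rrs trs crt; apply: contraTeq (c0 r rrs).
    by move=> rt; rewrite negbK -jdot_eq0 {2}crt orthc.
  move=> _ _ /mapP[r rrs ->] /mapP[t trs ->] rt; apply: orthc => //.
  by apply: contraNneq rt => ->.
rewrite -ux -sumc jmul_suml big_seq memv_suml // => r rrs.
by rewrite jmulC xc // memvZ // memv_span // map_f.
Qed.

End Spectral.

(** * Primitive idempotents and the existence of Jordan frames *)

Section Frames.
Variables (R : realType) (V : euclideanJordanType R).
Implicit Types (u x y z e f : V) (s : seq V).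

Lemma orth_idem_subdecomp u s c t : orth_idem_decomp u (c :: t) ->
  orth_idem_decomp (\sum_(d <- t) d) t.
Proof.
move=> [ids [/andP[_ ut] orths] _]; split=> //.
  by move=> d dt; apply: ids; rewrite inE dt orbT.
by split=> // y z yt zt; apply: orths; rewrite inE (yt, zt) orbT.
Qed.

Lemma orth_idem_mul u s c : orth_idem_decomp u s -> c \in s -> u *J c = c.
Proof.
move=> [ids [us orths] <-] cs; rewrite jmul_suml (bigD1_seq c) //=.
rewrite (ids c cs).2 big_seq_cond big1 ?addr0 // => d /andP[ds dc].
by apply: idem_orth; rewrite ?(ids d ds).2 ?(ids c cs).2 ?orths.
Qed.

Lemma orth_idem_sum_idem u s : orth_idem_decomp u s -> u *J u = u.
Proof.
move=> dec; have [_ _ su] := dec; rewrite -{2 3}su linear_sum /= big_seq_cond.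
rewrite [RHS]big_seq_cond; apply: eq_bigr => c; rewrite andbT => cs.
exact: orth_idem_mul dec cs.
Qed.

Lemma orth_idem_free u s : orth_idem_decomp u s -> free s.
Proof.
elim: s u => [|c s IH] u dec; first by rewrite nil_free.
rewrite free_cons (IH _ (orth_idem_subdecomp s dec)) andbT.
have [ids [/andP[cs us] orths] _] := dec.
apply/negP => cspan; have [c0 _] := ids c (mem_head _ _).
move: c0; rewrite -jdot_eq0 {2}(coord_span (X := in_tuple s) cspan) linear_sum.
rewrite big1 ?eqxx //= => i _.
have si : s`_i \in s by rewrite mem_nth.
rewrite jdotZr orths ?mulr0 ?mem_head // ?inE ?si ?orbT //.
by apply: contraNneq cs => ->.
Qed.

(** The spectral decomposition of [x] with [e] as unit has one idempotent only, for two or more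
    would split [e]. *)
Lemma primitive_peirce1 e x : primitive_idempotent e -> e *J x = x ->
  exists k, x = k *: e.
Proof.
move=> [[e0 ee] eprim] ex.
have [[|c s] dec xs] := spectral_idempotents ee ex; have [ids [us orths] sume] := dec.
  by move: e0; rewrite -sume big_nil eqxx.
case: s => [|d s] in dec us orths sume ids xs *.
  by move: sume xs; rewrite big_seq1 span_seq1 => -> /vlineP.
case: eprim; exists c, (\sum_(d <- d :: s) d).
have dec' := orth_idem_subdecomp (d :: s) dec.
split; last by rewrite -sume big_cons.
  exact: ids (mem_head _ _).
split; last exact: orth_idem_sum_idem dec'.
have [d0 dd] : d != 0 /\ d *J d = d by apply: ids; rewrite !inE eqxx orbT.
apply: contraNneq d0 => s0.
by rewrite -(orth_idem_mul dec' (mem_head _ _)) s0 jmul0l.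
Qed.

(** With [L] the multiplication by [e], [2 L^2 - L] maps into the Peirce space for 1, which is a
    line; pairing with [e] gives the coefficient. *)
Lemma primitive_projection e x : primitive_idempotent e ->
  2 *: (e *J (e *J x)) = e *J x + (jdot e x / jdot e e) *: e.
Proof.
move=> pe; have [[e0 ee] _] := pe.
have [||k hk] := @primitive_peirce1 e (2 *: (e *J (e *J x)) - e *J x) => //.
  apply: jdot_inj => z; move: (congr1 (jdot^~ z) (peirce_cubic x ee)).
  by rewrite !jmulE !jdotE; lra.
have kE : jdot e x = k * jdot e e.
  move: (congr1 (jdot^~ e) hk); rewrite !jdotE (jmulC e (e *J x)) jdot_assoc ee.
  by rewrite (jmulC e x) jdot_assoc ee (jdotC x); lra.
by rewrite kE mulfK ?jdot_eq0 // -hk addrC subrK.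
Qed.

Lemma idem_dot_unit e : e *J e = e -> jdot '1J e = jdot e e.
Proof. by move=> ee; rewrite jdotC -{1}ee jdot_sqr. Qed.

(* Both [(1 + <e,f>/<e,e>) <e,f>] and [(1 + <e,f>/<f,f>) <e,f>] are equal to
   [2 <ef,ef>]. *)
Lemma primitive_dot_ratio e f :
  primitive_idempotent e -> primitive_idempotent f ->
  jdot e f / jdot e e = jdot e f / jdot f f.
Proof.
have half e' f' : primitive_idempotent e' -> f' *J f' = f' ->
    2 * jdot (e' *J f') (e' *J f') = (1 + jdot e' f' / jdot e' e') * jdot e' f'.
  move=> pe ff; rewrite {1}(jmulC e' f') jdot_assoc jdotC -jdotZl.
  by rewrite primitive_projection // !jdotE jdot_assoc ff; ring.
move=> pe pf; have [[_ ee] _] := pe; have [[_ ff] _] := pf.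
have [->|ef0] := eqVneq (jdot e f) 0; first by rewrite !mul0r.
have := half e f pe ff; have := half f e pf ee.
by rewrite (jmulC f e) (jdotC f e) => -> /(mulIf ef0)/addrI.
Qed.

(** Among the decompositions of the unit whose span contains [x], one of maximal size is a frame:
    splitting a member [c = y + z] would give a longer one. *)
Lemma spectral_frame x : exists n (c : 'I_n -> V) (a : 'I_n -> R),
  jordan_frame c /\ x = \sum_i a i *: c i.
Proof.
pose P n := `[< exists s, [/\ orth_idem_decomp '1J s, x \in <<s>>%VS & size s = n] >].
have exP : exists n, P n.
  have [||s dec xs] := @spectral_idempotents _ V '1J x; rewrite ?jmulx1 //.
    by rewrite jmulC jmulx1.
  by exists (size s); apply/asboolP; exists s.
have Pdim n : P n -> (n <= \dim {:V})%N.
  move=> /asboolP[s [dec _ <-]].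
  by have /eqP <- := orth_idem_free dec; rewrite dimvS ?subvf.
case: (ex_maxnP exP Pdim) => n /asboolP[s [dec xs <-]] smax {exP Pdim}.
exists (size s), (tnth (in_tuple s)), (fun i => coord (in_tuple s) i x).
have [ids [us orths] sums] := dec.
split; last first.
  rewrite {1}(coord_span (X := in_tuple s) xs).
  by apply: eq_bigr => i _; rewrite (tnth_nth 0).
split; last first.
- by rewrite -[RHS]sums [RHS](big_tnth).
- move=> i j ij; apply: orths; rewrite ?mem_tnth //.
  apply: contraNneq ij; rewrite !(tnth_nth 0) /= => /eqP.
  by rewrite nth_uniq.
move=> i; set c := tnth _ i; have cs : c \in s by apply: mem_tnth.
split; first exact: ids.
move=> [y [z [[y0 yy] [z0 zz] cE]]].
have yz0 : y *J z = 0.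
  apply: jdot_inj => w; have := (ids c cs).2.
  rewrite cE !jmulE yy zz (jmulC z y) => /(congr1 (jdot^~ w)).
  by rewrite !jdotE; lra.
have yz : jdot y z = 0 by rewrite -yy jdot_assoc yz0 jdot0r.
(* Both pairings are nonnegative and their sum is [jdot c d = 0]. *)
have orthd d : d \in rem c s -> jdot y d = 0 /\ jdot z d = 0.
  rewrite mem_rem_uniq // inE => /andP[dc ds].
  have dd := (ids d ds).2; have := idem_dot_idem_ge0 yy dd.
  have := idem_dot_idem_ge0 zz dd; have : jdot c d = 0 by apply: orths; rewrite // eq_sym.
  by rewrite cE jdotDl; split; lra.
have ny (d w : V) : d != 0 -> jdot w d = 0 -> w != d.
  by move=> d0 wd; apply: contraNneq d0 => wE; rewrite -jdot_eq0 -{1}wE wd.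
have ns d : d \in rem c s -> d != 0 by move=> /mem_rem/ids[].
suff /smax : P (size s).+1 by rewrite ltnn.
apply/asboolP; exists [:: y, z & rem c s]; split; last first.
- by rewrite /= size_rem // prednK //; case: (s) cs.
- have: (<<s>> <= <<[:: y, z & rem c s]>>)%VS.
    apply/span_subvP => d ds; have [->|dc] := eqVneq d c.
      by rewrite cE memvD // memv_span // !inE eqxx ?orbT.
    by rewrite memv_span // !inE mem_rem_uniq // inE /= dc ds !orbT.
  by move/subvP; apply.
split.
- by move=> d; rewrite !inE => /or3P[/eqP->|/eqP->|/mem_rem/ids].
- split.
    rewrite /= rem_uniq // !inE andbT negb_or (ny z y) //=; apply/andP; split.
      by apply/negP => yr; have := (orthd y yr).1; apply/eqP; rewrite jdot_eq0.
    by apply/negP => zr; have := (orthd z zr).2; apply/eqP; rewrite jdot_eq0.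
  move=> d w; rewrite !inE => /or3P[/eqP->|/eqP->|dr] /or3P[/eqP->|/eqP->|wr] //;
    rewrite ?eqxx // => dw.
  + exact: (orthd w wr).1.
  + by rewrite jdotC.
  + exact: (orthd w wr).2.
  + by rewrite jdotC (orthd d dr).1.
  + by rewrite jdotC (orthd d dr).2.
  + by apply: orths => //; apply: mem_rem; eauto.
by rewrite !big_cons addrA -cE -sums (perm_big _ (perm_to_rem cs)) big_cons.
Qed.

End Frames.

(** * Jordan frames, rank and trace *)

Section JordanFrames.
Variables (R : realType) (V : euclideanJordanType R) (n : nat) (c : 'I_n -> V).
Hypothesis framec : jordan_frame c.
Implicit Types (x y z f : V).

Lemma frame_idem i : c i *J c i = c i.
Proof. by have [/(_ i) [[]]] := framec. Qed.

Lemma frame_neq0 i : c i != 0.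
Proof. by have [/(_ i) [[]]] := framec. Qed.

Lemma frame_norm_gt0 i : 0 < jdot (c i) (c i).
Proof. exact/jdot_gt0/frame_neq0. Qed.

Lemma frame_mul i j : i != j -> c i *J c j = 0.
Proof.
by move=> ij; apply: idem_orth; rewrite ?frame_idem //; have [_ ->] := framec.
Qed.

Lemma frame_mul_sum (a : 'I_n -> R) j : (\sum_i a i *: c i) *J c j = a j *: c j.
Proof.
rewrite jmul_suml (bigD1 j) //= jmulZl frame_idem big1 ?addr0 // => i ij.
by rewrite jmulZl frame_mul // scaler0.
Qed.

Lemma frame_mul_sums (a b : 'I_n -> R) :
  (\sum_i a i *: c i) *J (\sum_i b i *: c i) = \sum_i (a i * b i) *: c i.
Proof.
rewrite linear_sum; apply: eq_bigr => i _ /=.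
by rewrite jmulZr frame_mul_sum scalerA mulrC.
Qed.

Lemma frame_dot_sum (a : 'I_n -> R) j :
  jdot (\sum_i a i *: c i) (c j) = a j * jdot (c j) (c j).
Proof. by rewrite -jdotZl -frame_mul_sum jdot_assoc frame_idem. Qed.

Lemma frame_sum : \sum_i c i = '1J.
Proof. by have [] := framec. Qed.

Lemma frame_primitive i : primitive_idempotent (c i).
Proof. by have [/(_ i)] := framec. Qed.

(** By [primitive_dot_ratio] all denominators can be replaced by [jdot f f], and the numerators add
    up to [jdot '1J f]. *)
Lemma frame_dot_primitive f : primitive_idempotent f ->
  \sum_i jdot f (c i) / jdot (c i) (c i) = 1.
Proof.
move=> pf; have [[f0 ff] _] := pf.
rewrite (eq_bigr (fun i => jdot (c i) f / jdot f f)); last first.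
  by move=> i _; rewrite jdotC primitive_dot_ratio //; apply: frame_primitive.
by rewrite -mulr_suml -jdot_suml frame_sum idem_dot_unit // divff ?jdot_eq0.
Qed.

End JordanFrames.

(** * Rank, eigenvalues, trace and self-duality of the cone *)

Section RankTrace.
Variables (R : realType) (V : euclideanJordanType R).
Implicit Types (x y z f : V).

(** The left side involves [c] only through the vector: this makes the trace independent of the
    frame and, at the unit, gives equal lengths. *)
Lemma frame_sum_ratio n m (c : 'I_n -> V) (d : 'I_m -> V) (a : 'I_n -> R) :
  jordan_frame c -> jordan_frame d ->
  \sum_j jdot (\sum_i a i *: c i) (d j) / jdot (d j) (d j) = \sum_i a i.
Proof.
move=> fc fd; under eq_bigr do rewrite jdot_suml mulr_suml.
rewrite exchange_big; apply: eq_bigr => i _ /=.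
under eq_bigr do rewrite jdotZl -mulrA.
by rewrite -mulr_sumr (frame_dot_primitive fd) ?mulr1 //; apply: frame_primitive.
Qed.

Lemma frame_card n m (c : 'I_n -> V) (d : 'I_m -> V) :
  jordan_frame c -> jordan_frame d -> n = m.
Proof.
move=> fc fd; have := frame_sum_ratio (fun=> 1) fc fd.
under eq_bigr => j _.
  under eq_bigr do rewrite scale1r.
  rewrite (frame_sum fc) idem_dot_unit ?(frame_idem fd) //.
  rewrite divff ?lt0r_neq0 ?frame_norm_gt0 //; over.
by rewrite !sumr_const !card_ord => /eqP; rewrite eqr_nat => /eqP.
Qed.

Lemma jrank_frame n (c : 'I_n -> V) : jordan_frame c -> n = jrank V.
Proof.
move=> fc; have [d fd] : exists d : 'I_(jrank V) -> V, jordan_frame d.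
  rewrite /jrank; case: xgetP => [m -> //|/(_ n) []].
  by exists c.
exact: frame_card fc fd.
Qed.

(** Permuting a frame from [spectral_frame] sorts the coefficients, so the default value of [xget]
    does not occur. *)
Lemma eigenvaluesP x : sorted >=%R (eigenvalues x) /\
  exists2 c : 'I_(jrank V) -> V,
    jordan_frame c & x = \sum_i tnth (eigenvalues x) i *: c i.
Proof.
have [n [c [a [fc xE]]]] := spectral_frame x.
have nE := jrank_frame fc; subst n.
rewrite /eigenvalues; case: xgetP => [l _ //|]; pose t := [tuple a i | i < jrank V].
have /tuple_permP[s tE] : perm_eq (sort >=%R t) t by rewrite perm_sort.
move=> /(_ [tuple of sort >=%R t]) []; split=> /=.
  by apply: sort_sorted => u v; apply: le_total.
exists (c \o s).
  split=> [i|i j ij|] /=; first exact: frame_primitive.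
    by have [_ -> //] := fc; rewrite (inj_eq perm_inj).
  by rewrite -(frame_sum fc) [RHS](reindex_inj (@perm_inj _ s)).
rewrite xE (reindex_inj (@perm_inj _ s)); apply: eq_bigr => i _ /=.
congr (_ *: _); have -> : [tuple of sort >=%R t] = [tuple tnth t (s i) | i < jrank V].
  exact: val_inj.
by rewrite !tnth_mktuple.
Qed.

Lemma jtraceE n (c : 'I_n -> V) x : jordan_frame c ->
  jtrace x = \sum_i jdot x (c i) / jdot (c i) (c i).
Proof.
move=> fc; have [_ [d fd xE]] := eigenvaluesP x.
by rewrite [in RHS]xE (frame_sum_ratio _ fd fc).
Qed.

Lemma cone_idem f : f *J f = f -> in_cone f.
Proof. by exists f. Qed.

Lemma cone_dot_idem_ge0 x f : f *J f = f -> in_cone x -> 0 <= jdot x f.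
Proof. by move=> ff [y ->]; rewrite jdotC idem_sqr_dot_ge0. Qed.

Lemma cone_dot_idem_eq0 x f : f *J f = f -> in_cone x -> jdot x f = 0 -> f *J x = 0.
Proof. by move=> ff [y ->]; rewrite jdotC; apply: idem_sqr_dot_eq0. Qed.

(** Testing against the frame of [x] shows that its coefficients are nonnegative; their square roots
    give an element with square [x]. *)
Lemma in_cone_dual x : (forall f, f *J f = f -> 0 <= jdot x f) -> in_cone x.
Proof.
move=> x_ge0; have [n [c [a [fc xE]]]] := spectral_frame x.
have a0 i : 0 <= a i.
  have := x_ge0 _ (frame_idem fc i).
  by rewrite xE frame_dot_sum // pmulr_lge0 ?frame_norm_gt0.
exists (\sum_i Num.sqrt (a i) *: c i); rewrite frame_mul_sums // xE.
by apply: eq_bigr => i _; rewrite -expr2 sqr_sqrtr.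
Qed.

Lemma cone_dot_ge0 x y : in_cone x -> in_cone y -> 0 <= jdot x y.
Proof.
move=> xK [z ->]; have [n [c [a [fc xE]]]] := spectral_frame x.
rewrite xE jdot_suml sumr_ge0 // => i _; rewrite jdotZl.
rewrite mulr_ge0 ?idem_sqr_dot_ge0 ?(frame_idem fc) //.
have := cone_dot_idem_ge0 (frame_idem fc i) xK.
by rewrite xE frame_dot_sum // pmulr_lge0 ?frame_norm_gt0.
Qed.

End RankTrace.

(** * Adjoint *)

Section Adjoint.
Variables (R : realType) (V : euclideanJordanType R) (T : 'End(V)).

Let b i := (vbasis {: V})`_i.

(* As [b] is a basis, [gram \1] is injective, and the adjoint of [T] is
   [(gram \1)^-1 \o gram T]. *)
Definition gram (S : 'End(V)) (y : V) : V :=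
  \sum_(i < \dim {: V}) jdot (S (b i)) y *: b i.

Fact gram_linear S : linear (gram S).
Proof.
move=> k y z; rewrite /gram scaler_sumr -big_split /=.
by apply: eq_bigr => i _; rewrite linearP scalerDl scalerA.
Qed.
HB.instance Definition _ S := GRing.isLinear.Build R V V _ (gram S) (gram_linear S).

Lemma basis_dot_inj (S : 'End(V)) y z :
  (forall i : 'I_(\dim {: V}), jdot (S (b i)) y = jdot (b i) z) ->
  forall x, jdot (S x) y = jdot x z.
Proof.
move=> h x; rewrite (coord_vbasis (memvf x)) linear_sum !jdot_suml /=.
by apply: eq_bigr => i _; rewrite linearZ !jdotZl h.
Qed.

Lemma adjoint_exists : exists S : 'End(V), forall x y, jdot (T x) y = jdot x (S y).
Proof.
pose G := linfun (gram \1).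
have frb (k : 'I_(\dim {: V}) -> R) : \sum_i k i *: b i = 0 -> forall i, k i = 0.
  exact/freeP/basis_free/vbasisP.
have G0 : lker G == 0%VS.
  apply/lker0P => y z; rewrite !lfunE /= => /eqP; rewrite -subr_eq0 -sumrB => /eqP yz.
  apply: jdot_inj => x; rewrite !(jdotC _ x).
  rewrite -[x in LHS](id_lfunE x); apply: basis_dot_inj => i.
  have h := frb (fun i => jdot (b i) y - jdot (b i) z).
  rewrite id_lfunE; apply/eqP; rewrite -subr_eq0; apply/eqP/h; rewrite -[RHS]yz.
  by apply: eq_bigr => j _; rewrite !id_lfunE scalerBl.
exists (G^-1 \o linfun (gram T))%VF => x y; apply: basis_dot_inj => i.
have h := frb (fun i => jdot (T (b i)) y - jdot (b i) ((G^-1 \o linfun (gram T))%VF y)).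
apply/eqP; rewrite -subr_eq0; apply/eqP/h.
under eq_bigr do rewrite scalerBl.
apply/eqP; rewrite sumrB subr_eq0; apply/eqP.
have -> : \sum_(i < \dim {: V}) jdot (T (b i)) y *: b i = linfun (gram T) y.
  by rewrite lfunE.
have : G (G^-1%VF (linfun (gram T) y)) = linfun (gram T) y.
  by rewrite lker0_lfunVK.
rewrite {1}/G lfunE /= => <-; apply: eq_bigr => j _.
by rewrite id_lfunE comp_lfunE.
Qed.

Lemma adjointP x y : jdot (T x) y = jdot x (adjoint T y).
Proof.
rewrite /adjoint; case: xgetP => [S _ -> //|H].
by have [S hS] := adjoint_exists; case: (H S).
Qed.

Lemma adjoint_positive : positive_map T -> positive_map (adjoint T).
Proof.
move=> posT x xK; apply: in_cone_dual => f ff.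
by rewrite jdotC -adjointP cone_dot_ge0 //; apply/posT/cone_idem.
Qed.

End Adjoint.

(** * Majorization *)

Section Majorization.
Variables (R : realType) (n : nat).
Implicit Types (u v : n.-tuple R).

Lemma partial_sum_sorted u k : sorted >=%R u ->
  partial_sum u k = \sum_(i < n | (i < k)%N) tnth u i.
Proof.
move=> su; rewrite /partial_sum; suff -> : decreasing_rearrangement u = u by [].
by apply: val_inj => /=; rewrite sorted_sort // => x y z yx xz; apply: le_trans xz yx.
Qed.

(** The first [k] entries of [u] add up to a combination of the entries of [v] with weights in [0,1]
    of total [k], which is largest when the weights sit on the first [k] entries. *)
Lemma stochastic_majorized u v (N : 'I_n -> 'I_n -> R) :
  sorted >=%R u -> sorted >=%R v -> (forall i j, 0 <= N i j) ->
  (forall i, \sum_j N i j = 1) -> (forall j, \sum_i N i j = 1) ->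
  (forall j, tnth u j = \sum_i N i j * tnth v i) -> majorized u v.
Proof.
move=> su sv N0 Nrow Ncol uE.
have psE k : partial_sum u k =
    \sum_i (\sum_(j < n | (j < k)%N) N i j) * tnth v i.
  rewrite partial_sum_sorted //; under eq_bigr do rewrite uE.
  by rewrite exchange_big; apply: eq_bigr => i _; rewrite mulr_suml.
split=> [k /andP[k0 kn]|]; last first.
  rewrite psE partial_sum_sorted //; apply: eq_big => [i|i _].
    by rewrite ltn_ord.
  by rewrite (eq_bigl xpredT) ?Nrow ?mul1r // => j; rewrite ltn_ord.
have ltk : (k.-1 < n)%N by rewrite prednK.
(* The [k]-th largest entry of [v]. As the [d i] add up to 0, subtracting [t] from all entries
   changes nothing, and each term [d i * (tnth v i - t)] is at most 0. *)
pose t := tnth v (Ordinal ltk).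
have vmono (i j : 'I_n) : (i <= j)%N -> tnth v j <= tnth v i.
  move=> ij; rewrite !(tnth_nth 0).
  apply: (sorted_leq_nth _ _ 0 sv); rewrite ?inE ?size_tuple //.
    by move=> x y z yx xz; apply: le_trans xz yx.
  by move=> x; apply: lexx.
pose d (i : 'I_n) : R := \sum_(j < n | (j < k)%N) N i j - (i < k)%N%:R.
have d0 : \sum_i d i = 0.
  rewrite sumrB exchange_big /= (eq_bigr (fun=> 1)) // [X in X - _]big_mkcond -sumrB.
  by rewrite big1 // => j _; case: ifP; rewrite subrr.
rewrite -subr_le0.
have -> : partial_sum u k - partial_sum v k = \sum_i d i * (tnth v i - t).
  under [RHS]eq_bigr do rewrite mulrBr.
  rewrite sumrB -mulr_suml d0 mul0r subr0 psE (partial_sum_sorted _ sv).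
  rewrite [X in _ - X]big_mkcond -sumrB; apply: eq_bigr => i _.
  by rewrite mulrBl; case: ltnP; rewrite ?mul1r ?mul0r.
rewrite -oppr_ge0 -sumrN sumr_ge0 // => i _; rewrite oppr_ge0 /d.
have w1 : \sum_(j < n | (j < k)%N) N i j <= 1.
  rewrite -(Nrow i) [leRHS](bigID (fun j : 'I_n => (j < k)%N)) /= lerDl.
  by rewrite sumr_ge0.
case: ltnP => ik.
  by rewrite mulr_le0_ge0 ?subr_le0 ?subr_ge0 // vmono //= -ltnS prednK.
rewrite subr0 mulr_ge0_le0 ?sumr_ge0 // subr_le0 vmono //=.
by rewrite (leq_trans (leq_pred _)).
Qed.

End Majorization.

(** * Maps fixing a Jordan frame *)

Section FixedFrame.
Variables (R : realType) (V : euclideanJordanType R) (n : nat) (c : 'I_n -> V).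
Hypothesis framec : jordan_frame c.
Implicit Types (S T : 'End(V)).

(** The products of [x] with the other [c i] vanish, so [x = x *J '1J = c j *J x] lies on the line
    of [c j]. *)
Lemma cone_dual_frame x j : in_cone x ->
  (forall i, i != j -> jdot x (c i) = 0) -> jdot x (c j) = jdot (c j) (c j) ->
  x = c j.
Proof.
move=> xK xc0 xcj.
have cx : c j *J x = x.
  rewrite -[RHS]jmulx1 -(frame_sum framec) linear_sum /= (bigD1 j) //= big1 ?addr0.
    by rewrite jmulC.
  move=> i /xc0 xci; rewrite jmulC; apply: cone_dot_idem_eq0 => //.
  exact: frame_idem.
have [k xE] := primitive_peirce1 (frame_primitive framec j) cx.
move: xcj; rewrite xE jdotZl -{2}[jdot _ _]mul1r => /mulIf -> //.
  by rewrite scale1r.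
by rewrite lt0r_neq0 ?frame_norm_gt0.
Qed.

(** Stated for any adjoint pair, so that it serves from [T] to [adjoint T] and back. *)
Lemma frame_fixed_adjoint S T : positive_map S ->
  (forall x y, jdot (T x) y = jdot x (S y)) ->
  (forall i, T (c i) = c i) -> forall j, S (c j) = c j.
Proof.
move=> posS adjS Tc j; apply: cone_dual_frame.
- exact/posS/cone_idem/frame_idem.
- by move=> i ij; rewrite jdotC -adjS Tc; have [_ ->] := framec.
- by rewrite jdotC -adjS Tc.
Qed.

(* The coefficients of the [S (c j)] on [c i] are weights on the points [a j];
   as their mean is [a i] and their variance is 0, they are concentrated on
   [a i]. *)
Lemma frame_fixed_moments S (a : 'I_n -> R) : positive_map S -> injective a ->
  let p := \sum_i a i *: c i in
  S '1J = '1J -> S p = p -> S (p *J p) = p *J p -> forall j, S (c j) = c j.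
Proof.
move=> posS inja p S1 Sp Sp2.
have Scone j : in_cone (S (c j)) by exact/posS/cone_idem/frame_idem.
have mom (b : 'I_n -> R) i : S (\sum_j b j *: c j) = \sum_j b j *: c j ->
    \sum_j b j * jdot (S (c j)) (c i) = b i * jdot (c i) (c i).
  move=> Sb; rewrite -frame_dot_sum // -Sb linear_sum jdot_suml.
  by apply: eq_bigr => j _; rewrite linearZ jdotZl.
have var i : \sum_j (a j - a i) ^+ 2 * jdot (S (c j)) (c i) = 0.
  have m0 := mom (fun=> 1) i.
  have m1 := mom a i Sp.
  have m2 := mom (fun j => a j * a j) i.
  rewrite -frame_mul_sums // in m2; have {}m2 := m2 Sp2.
  have {}m0 : \sum_j jdot (S (c j)) (c i) = jdot (c i) (c i).
    by rewrite -jdot_suml -linear_sum /= frame_sum // S1 idem_dot_unit // frame_idem.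
  transitivity (\sum_j a j * a j * jdot (S (c j)) (c i)
    - 2 * a i * \sum_j a j * jdot (S (c j)) (c i)
    + a i * a i * \sum_j jdot (S (c j)) (c i)).
    rewrite !mulr_sumr -sumrB -big_split; apply: eq_bigr => j _ /=; ring.
  by rewrite m0 m1 m2; ring.
have off i j : j != i -> jdot (S (c j)) (c i) = 0.
  move=> ji; have /eqP := var i; rewrite psumr_eq0; last first.
    by move=> k _; rewrite mulr_ge0 ?sqr_ge0 // cone_dot_idem_ge0 ?frame_idem.
  move=> /allP/(_ j (mem_index_enum _)); rewrite mulf_eq0 sqrf_eq0 subr_eq0.
  by rewrite (inj_eq inja) (negbTE ji) => /eqP.
move=> j; apply: cone_dual_frame => // [i ij|]; first by rewrite off // eq_sym.
(* Once the off-diagonal pairings vanish, pairing [S '1J = '1J] with [c j] gives the diagonal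
   one. *)
have : jdot (S '1J) (c j) = jdot '1J (c j) by rewrite S1.
rewrite -(frame_sum framec) linear_sum !jdot_suml (bigD1 j) //= big1 ?addr0.
  rewrite (bigD1 j) //= [X in _ + X]big1 ?addr0 // => i ij.
  by have [_ ->] := framec.
by move=> i ij; rewrite off.
Qed.

Lemma frame_span_fixed S :
  (forall j, S (c j) = c j) -> forall h, h \in <<codom c>>%VS -> S h = h.
Proof.
move=> Sc h; suff /subvP sub : (<<codom c>> <= fixedSpace S)%VS.
  by move/sub/fixedSpaceP.
by apply/span_subvP => _ /codomP[j ->]; apply/fixedSpaceP.
Qed.

Lemma frame_in_span (b : 'I_n -> R) : \sum_i b i *: c i \in <<codom c>>%VS.
Proof. by apply: memv_suml => i _; rewrite memvZ // memv_span // codom_f. Qed.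

Lemma frame_moments_in_span (a : 'I_n -> R) h :
  let p := \sum_i a i *: c i in
  h \in [:: '1J; p; p *J p] -> h \in <<codom c>>%VS.
Proof.
move=> p; rewrite !inE => /or3P[] /eqP->.
- rewrite -(frame_sum framec) (eq_bigr (fun i => 1 *: c i)) ?frame_in_span // => i _.
  by rewrite scale1r.
- exact: frame_in_span.
- by rewrite frame_mul_sums // frame_in_span.
Qed.

Lemma frame_fixed_unital T : (forall j, T (c j) = c j) -> unital T.
Proof.
move=> Tc; rewrite /unital -(frame_sum framec) linear_sum.
by apply: eq_bigr => j _; apply: Tc.
Qed.

(** The trace is a combination of the pairings with the [c i], and [adjoint T] fixes these. *)
Lemma frame_fixed_trace T : (forall j, adjoint T (c j) = c j) -> trace_preserving T.
Proof.
move=> Tc x; rewrite !(jtraceE _ framec); apply: eq_bigr => i _.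
by rewrite adjointP Tc.
Qed.

End FixedFrame.

(** The matrix [N] compares the image under [T] of a frame of [x] with a frame of [T x]. Its row
    sums are the traces of the [T (c i)], equal to 1 as [T] preserves the trace; its column sums are
    1 because [T] is unital. *)
Lemma doubly_stochastic_majorized (R : realType) (V : euclideanJordanType R)
    (T : 'End(V)) (x : V) : doubly_stochastic T -> jmajorized (T x) x.
Proof.
move=> [posT unitT trT]; rewrite /jmajorized.
have [sl [c fc xE]] := eigenvaluesP x; have [sm [d fd TxE]] := eigenvaluesP (T x).
pose N i j := jdot (T (c i)) (d j) / jdot (d j) (d j).
have dd j : jdot (d j) (d j) != 0 by rewrite lt0r_neq0 ?frame_norm_gt0.
apply: (stochastic_majorized (N := N)) => //.
- move=> i j; rewrite divr_ge0 ?jdot_ge0 // cone_dot_idem_ge0 ?(frame_idem fd) //.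
  exact/posT/cone_idem/frame_idem.
- move=> i; rewrite -(jtraceE _ fd) trT (jtraceE _ fd) frame_dot_primitive //.
  exact: frame_primitive.
- move=> j; rewrite -mulr_suml -jdot_suml -linear_sum /= frame_sum // unitT.
  by rewrite idem_dot_unit ?divff // frame_idem.
move=> j; apply: (mulIf (dd j)); rewrite -frame_dot_sum // -TxE {1}xE.
rewrite linear_sum jdot_suml mulr_suml; apply: eq_bigr => i _ /=.
by rewrite linearZ jdotZl /= mulrAC divfK // mulrC.
Qed.

Theorem theorem4p2 (R : realType) (V : euclideanJordanType R) (n : nat)
    (rankV : jrank V = n)
    (T : 'End(V)) (posT : positive_map T)
    (c : 'I_n -> V) (framec : jordan_frame c)
    (a : 'I_n -> R) (inja : injective a)
    (p : V) (pE : p = \sum_i a i *: c i) :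
  let condA := forall h, h \in [:: '1J; p; p *J p] -> T h = h in
  let condB := forall h, h \in <<codom c>>%VS -> T h = h in
  let condC := forall h, h \in <<codom c>>%VS -> adjoint T h = h in
  let condD := forall h, h \in [:: '1J; p; p *J p] -> adjoint T h = h in
  [<-> condA; condB; condC; condD] /\
  (condA \/ condB \/ condC \/ condD ->
    doubly_stochastic T /\ forall x : V, jmajorized (T x) x).
Proof.
move=> condA condB condC condD; subst p.
have posT' := adjoint_positive posT.
have adjT' x y : jdot (adjoint T x) y = jdot x (T y).
  by rewrite jdotC -adjointP jdotC.
have momB S : positive_map S ->
    (forall h, h \in [:: '1J; \sum_i a i *: c i;
       (\sum_i a i *: c i) *J (\sum_i a i *: c i)] -> S h = h) ->
    forall j, S (c j) = c j.
  by move=> posS fixS; apply: frame_fixed_moments inja _ _ _ => //;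
    apply: fixS; rewrite !inE eqxx ?orbT.
have fixc S : (forall h, h \in <<codom c>>%VS -> S h = h) ->
    forall j, S (c j) = c j.
  by move=> fixS j; rewrite fixS // memv_span // codom_f.
have AB : condA -> condB by move=> /(momB T posT)/frame_span_fixed.
have BC : condB -> condC.
  move=> /fixc/(frame_fixed_adjoint framec posT' (adjointP T)).
  exact: frame_span_fixed.
have CD : condC -> condD by move=> fixT h /(frame_moments_in_span framec)/fixT.
(* The moment argument applies to [adjoint T], whose adjoint is [T]. *)
have DB : condD -> condB.
  move=> /(momB _ posT')/(frame_fixed_adjoint framec posT adjT').
  exact: frame_span_fixed.
have BA : condB -> condA by move=> fixT h /(frame_moments_in_span framec)/fixT.
split; first by tfae; tauto.
move=> H; have hB : condB by tauto.
have dsT : doubly_stochastic T.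
  split=> //; first exact/(frame_fixed_unital framec)/fixc.
  exact/(frame_fixed_trace framec)/fixc/BC.
by split=> // x; apply: doubly_stochastic_majorized.
Qed.
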